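(* Let $n$ be any positive odd integer. Then $$\frac1n\sum_{r=0}^{n-1}\csc 2\pi\frac{x+r}{n}=\csc 2\pi x$$ for all $x\in\mathbb{C}$ with $2x\notin\mathbb{Z}$, and $$\frac1n\sum_{r=0}^{n-1}\sec 2\pi\frac{x+r}{n}=\left(\frac{-1}{n}\right)\sec 2\pi x$$ for any $x\in\mathbb{C}$ such that $4x$ is not an odd integer.
   Context: For a positive odd integer $n$, $\left(\frac{\cdot}{n}\right)$ denotes the Jacobi symbol; in particular $\left(\frac{-1}{n}\right)=(-1)^{(n-1)/2}$. *)

(* Defs.v *)
From HB Require Import structures.
From mathcomp Require Import all_boot all_order all_algebra.
From mathcomp Require Import complex.
From mathcomp Require Import reals sequences exp trigo.

Set Implicit Arguments.
Unset Strict Implicit.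
Unset Printing Implicit Defensive.

Import Order.TTheory GRing.Theory Num.Theory.

Local Open Scope ring_scope.
Local Open Scope complex_scope.

(* Meaningful for p an odd prime. *)
Definition legendre (a : int) (p : nat) : int :=
  if (p %| a)%Z then 0
  else if [exists b : 'I_p, (b%:Z ^+ 2 == a %[mod p])%Z] then 1 else -1.

(* Meaningful for n odd and positive; the empty product gives jacobi a 1 = 1. *)
Definition jacobi (a : int) (n : nat) : int :=
  \prod_(p <- primes n) legendre a p ^+ logn p n.

Section ComplexTrigo.
Variable R : realType.
Implicit Type z : R[i].

(* exp (x + iy) = exp x (cos y + i sin y) *)
Definition expC z : R[i] :=
  (expR (complex.Re z))%:C * (cos (complex.Im z) +i* sin (complex.Im z)).

Definition sinC z : R[i] := (expC ('i%C * z) - expC (- ('i%C * z))) / (2 * 'i%C).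

Definition cosC z : R[i] := (expC ('i%C * z) + expC (- ('i%C * z))) / 2.

(* As in any field, 0^-1 = 0: cscC and secC vanish at the poles. *)
Definition cscC z : R[i] := (sinC z)^-1.

Definition secC z : R[i] := (cosC z)^-1.

End ComplexTrigo.

(* Main.v *)
(* With u = exp(iz) one has csc z = 2i u / (u^2 - 1). When z runs over
   2 pi (x + r) / n, u runs over the n-th roots of W = exp(2 pi i x), and
   u / (u^2 - 1) = (W^2 - 1)^-1 * \sum_(k < n) u^(2k+1). Summing over r kills
   every power except u^n = W, since n divides 2k+1 only for k = (n-1)/2.
   The secant identity is the cosecant identity at x + n/4, because
   csc (z + n pi/2) = (-1)^((n-1)/2) sec z and (-1)^((n-1)/2) = (-1/n). *)
Require Import Defs.
From HB Require Import structures.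
From mathcomp Require Import all_boot all_order all_algebra.
From mathcomp Require Import complex.
From mathcomp Require Import reals sequences exp trigo.
From mathcomp Require Import finfield ring zify.

Set Implicit Arguments.
Unset Strict Implicit.
Unset Printing Implicit Defensive.

Import Order.TTheory GRing.Theory Num.Theory.

Local Open Scope ring_scope.
Local Open Scope complex_scope.

(** * Sums over roots of unity in a field *)

Lemma unity_root_sum (F : fieldType) (n : nat) (z : F) :
  z ^+ n = 1 -> z != 1 -> \sum_(r < n) z ^+ r = 0.
Proof.
move=> zn1 z_neq1; apply: (mulfI (x := z - 1)); first by rewrite subr_eq0.
by rewrite -subrX1 zn1 subrr mulr0.
Qed.

Lemma sum_frac_prim_root (F : fieldType) (n : nat) (z w : F) :
  odd n -> n.-primitive_root z -> w ^+ n ^+ 2 != 1 ->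
  \sum_(r < n) (w * z ^+ r) / ((w * z ^+ r) ^+ 2 - 1)
  = n%:R * (w ^+ n / (w ^+ n ^+ 2 - 1)).
Proof.
move=> n_odd z_prim w_pole; set d := w ^+ n ^+ 2 - 1.
have d_neq0 : d != 0 by rewrite subr_eq0.
(* Since [u ^+ 2 ^+ n = w ^+ n ^+ 2] whatever [r] is, the geometric sum gives all terms the same
   denominator [d]. *)
have fracE (r : 'I_n) : (w * z ^+ r) / ((w * z ^+ r) ^+ 2 - 1)
    = d^-1 * \sum_(k < n) (w * z ^+ r) ^+ k.*2.+1.
  set u := w * z ^+ r.
  have un : u ^+ 2 ^+ n = w ^+ n ^+ 2.
    by rewrite exprAC exprMn [z ^+ r ^+ n]exprAC (prim_expr_order z_prim) expr1n mulr1.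
  have geom : d = (u ^+ 2 - 1) * \sum_(k < n) (u ^+ 2) ^+ k.
    by rewrite /d -un subrX1.
  have u_pole : u ^+ 2 - 1 != 0.
    by apply: contraNneq d_neq0 => u1; rewrite geom u1 mul0r.
  have -> : \sum_(k < n) u ^+ k.*2.+1 = u * \sum_(k < n) (u ^+ 2) ^+ k.
    rewrite mulr_sumr; apply: eq_bigr => k _.
    by rewrite exprS -exprM mul2n.
  apply: (mulfI d_neq0); rewrite mulVKf // {1}geom; field.
  exact: u_pole.
under eq_bigr => r _ do rewrite fracE.
rewrite -mulr_sumr exchange_big /=.
have innerE (k : 'I_n) : \sum_(r < n) (w * z ^+ r) ^+ k.*2.+1
    = if k == n./2 :> nat then n%:R * w ^+ n else 0.
  under eq_bigr => r _ do rewrite exprMn [z ^+ r ^+ _]exprAC.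
  rewrite -mulr_sumr; case: eqP => [k_half|k_nhalf].
    have -> : k.*2.+1 = n by lia.
    rewrite (prim_expr_order z_prim).
    under eq_bigr => r _ do rewrite expr1n.
    by rewrite sumr_const card_ord mulrC.
  rewrite unity_root_sum ?mulr0 //.
    by rewrite exprAC (prim_expr_order z_prim) expr1n.
  (* If 2k + 1 = qn with k < n, then q < 2; q = 0 is absurd, and q = 1 is the excluded case k =
     (n-1)/2. *)
  rewrite -(prim_order_dvd z_prim); apply/negP => /dvdnP[q kq].
  have k_ltn := ltn_ord k.
  have : (q < 2)%N by nia.
  case: q kq => [|[|q]] //; lia.
under eq_bigr => k _ do rewrite innerE.
have half_ltn : (n./2 < n)%N by lia.
rewrite -big_mkcond (big_pred1 (Ordinal half_ltn)) /=; first by rewrite mulrC mulrA.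
by move=> k; rewrite /= -val_eqE.
Qed.

(** * The complex exponential and its periods *)

Section ComplexExponential.
Variable R : realType.
Implicit Types (x y z : R[i]) (t : R).

Lemma ic_neq0 : 'i%C != 0 :> R[i].
Proof. by rewrite eq_complex /= oner_eq0 andbF. Qed.

Lemma pic_neq0 : pi%:C != 0 :> R[i].
Proof. by rewrite eq_complex /= gt_eqF ?pi_gt0. Qed.

Lemma expC0 : expC (0 : R[i]) = 1.
Proof. by rewrite /expC /= expR0 cos0 sin0 mul1r. Qed.

Lemma expCD x y : expC (x + y) = expC x * expC y.
Proof.
rewrite /expC; case: x y => a b [c d] /=; rewrite expRD cosD sinD.
by simpc; apply/eqP; rewrite eq_complex /=; apply/andP; split; apply/eqP; ring.
Qed.

Lemma expCMn n z : expC (z *+ n) = expC z ^+ n.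
Proof. by elim: n => [|n IHn]; rewrite ?expC0 // mulrS exprS expCD IHn. Qed.

Lemma expC_neq0 z : expC z != 0.
Proof.
have : expC z * expC (- z) != 0 by rewrite -expCD subrr expC0 oner_neq0.
by rewrite mulf_eq0 negb_or => /andP[].
Qed.

Lemma expCN z : expC (- z) = (expC z)^-1.
Proof.
by apply: (mulfI (expC_neq0 z)); rewrite -expCD subrr expC0 divff ?expC_neq0.
Qed.

(** Subtracting the multiple of pi given by the floor of t / pi leaves a zero of sine in [0, pi),
    and sine is positive on (0, pi). *)
Lemma sin_eq0_pi t : sin t = 0 -> exists k : int, t = k%:~R * pi.
Proof.
move=> t0; pose k := Num.floor (t / pi); exists k; pose s := t - k%:~R * pi.
have s_itv : 0 <= s < pi.
  rewrite subr_ge0 ltrBlDl -ler_pdivlMr ?pi_gt0 // floor_le.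
  have := floorD1_gt (t / pi); rewrite ltr_pdivrMr ?pi_gt0 // rmorphD mulrDl mul1r.
  by rewrite -ltrBlDl.
have s0 : sin s = 0.
  (* [alternatingn] covers natural multiples of pi only; negative ones reduce to it by oddness of
     sine. *)
  rewrite /s -mulNr -rmorphN; case: (- k) => m.
    by rewrite mulr_natl (alternatingn (@sinDpi R)) t0 mulr0.
  by rewrite NegzE rmorphN mulNr -[t]opprK -opprD sinN mulr_natl
    (alternatingn (@sinDpi R)) sinN t0 oppr0 mulr0 oppr0.
apply/eqP; rewrite -subr_eq0 -/s; apply: contraT => s_neq0.
have /sin_gt0_pi : 0 < s < pi by rewrite lt_neqAle eq_sym s_neq0.
by rewrite s0 ltxx.
Qed.

(** Here exp z is 1 or -1: its imaginary part forces sin b = 0, so |cos b| = 1, and then its modulus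
    forces exp a = 1. *)
Lemma expC_sqr_eq1 z : expC z ^+ 2 = 1 ->
  exists k : int, z = 'i%C * (k%:~R * pi%:C).
Proof.
case: z => a b /eqP; rewrite sqrf_eq1 /expC /=; simpc; rewrite !eq_complex /= => H.
have eab : expR a * sin b = 0 by move: H => /orP[] /andP[_ /eqP ->] //; rewrite oppr0.
have sb : sin b = 0 by move/eqP: eab; rewrite mulf_eq0 gt_eqF ?expR_gt0 //= => /eqP.
have a0 : a = 0.
  have cb : `|cos b| = 1 by exact: sin0cos1.
  have : `|expR a * cos b| = 1 by move: H => /orP[] /andP[/eqP -> _]; rewrite ?normrN normr1.
  rewrite normrM cb mulr1 ger0_norm ?expR_ge0 // -[1]expR0; exact: expR_inj.
have [k bE] := @sin_eq0_pi b sb; exists k.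
by rewrite a0 bE -(rmorph_int (real_complex R)) -rmorphM /=; simpc.
Qed.

(** Valid at the poles too: there u^2 = 1 and both sides are 0, because 0^-1 = 0. *)
Lemma cscCE z : cscC z = 2 * 'i%C * (expC ('i%C * z) / (expC ('i%C * z) ^+ 2 - 1)).
Proof.
rewrite /cscC /sinC expCN; set u := expC _.
have u0 : u != 0 by exact: expC_neq0.
have -> : u - u^-1 = (u ^+ 2 - 1) / u by field.
by rewrite !invfM !invrK mulrC [u / _]mulrC.
Qed.

Lemma expC_ipi : expC ('i%C * pi%:C) = - 1 :> R[i].
Proof. by rewrite /expC /=; simpc; rewrite cospi sinpi expR0; simpc. Qed.

Lemma expC_ipihalf : expC ('i%C * (pi / 2)%:C) = 'i%C :> R[i].
Proof. by rewrite /expC /=; simpc; rewrite cos_pihalf sin_pihalf expR0; simpc. Qed.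
End ComplexExponential.

(** * Shifts of the argument and the cosecant sum *)

Lemma sinCDpi (R : realType) (z : R[i]) : sinC (z + pi%:C) = - sinC z.
Proof.
rewrite /sinC mulrDr opprD !expCD (expCN ('i%C * pi%:C)) expC_ipi invrN1 !mulrN1.
by rewrite -opprD mulNr.
Qed.

Lemma sinCDpihalf (R : realType) (z : R[i]) : sinC (z + (pi / 2)%:C) = cosC z.
Proof.
have iV : 'i%C^-1 = - 'i%C :> R[i].
  by apply: (mulfI (ic_neq0 R)); rewrite divff ?ic_neq0 // mulrN -expr2 sqr_i opprK.
rewrite /sinC /cosC mulrDr opprD !expCD [expC (- ('i%C * (pi / 2)%:C))]expCN.
by rewrite expC_ipihalf iV mulrN opprK -mulrDl -mulf_div divff ?ic_neq0 // mulr1.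
Qed.

(** Split n pi/2 as pi/2 + ((n-1)/2) pi: the first shift turns sine into cosine, and each further pi
    flips the sign. *)
Lemma cscCD_odd_pihalf (R : realType) (n : nat) (z : R[i]) : odd n ->
  cscC (z + (pi / 2)%:C *+ n) = (-1) ^+ n./2 * secC z.
Proof.
move=> n_odd; rewrite /cscC /secC -sinCDpihalf.
have -> : z + (pi / 2)%:C *+ n = z + (pi / 2)%:C + pi%:C *+ n./2.
  rewrite -addrA -{1}[n]odd_double_half n_odd mulrnDr mulr1n -mul2n mulrnA -rmorphMn /=.
  by rewrite -[X in X%:C *+ n./2]mulr_natr divfK ?pnatr_eq0 // addrA.
by rewrite (alternatingn (@sinCDpi R)) invfM -exprVn invrN1.
Qed.

Lemma prim_root_expC (R : realType) (n : nat) : odd n ->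
  n.-primitive_root (expC ('i%C * (2 * pi%:C / n%:R)) : R[i]).
Proof.
move=> n_odd; have n_gt0 : (0 < n)%N by case: n n_odd.
have n_neq0 : n%:R != 0 :> R[i] by rewrite pnatr_eq0 -lt0n.
set z := expC _.
have zn1 : z ^+ n = 1.
  rewrite -expCMn -mulrnAr -mulr_natr divfK // mulr_natl mulr2n mulrDr expCD.
  by rewrite expC_ipi mulrNN mulr1.
have [m z_prim m_dvd] := prim_order_exists n_gt0 zn1.
suff n_dvd : (n %| m)%N by have <- : m = n by apply/eqP; rewrite eqn_dvd m_dvd.
(* Squaring makes [expC_sqr_eq1] applicable; it yields 2m = kn, and n being odd, n divides m. *)
have : z ^+ m ^+ 2 = 1 by rewrite (prim_expr_order z_prim) expr1n.
rewrite -expCMn => /expC_sqr_eq1[k]; rewrite -mulrnAr => /(mulfI (ic_neq0 R)) kE.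
have two_m : (2 * m)%N%:Z = k * n%:Z.
  apply: (@intr_inj R[i]); rewrite rmorphM /= -!pmulrn.
  apply: (mulfI (pic_neq0 R)); rewrite [RHS]mulrCA mulrA -kE -mulr_natr natrM; field.
  exact: n_neq0.
have : (n %| 2 * m)%N by rewrite -[(2 * m)%N]/(`|(2 * m)%N%:Z|%N) two_m abszM dvdn_mull.
by rewrite Gauss_dvdr // coprimen2.
Qed.

Lemma sum_cscC (R : realType) (n : nat) (x : R[i]) : odd n ->
  ~ (exists m : int, 2 * x = m%:~R) ->
  n%:R^-1 * (\sum_(r < n) cscC (2 * pi%:C * ((x + r%:R) / n%:R)))
  = cscC (2 * pi%:C * x).
Proof.
move=> n_odd x_pole; have n_gt0 : (0 < n)%N by case: n n_odd.
have n_neq0 : n%:R != 0 :> R[i] by rewrite pnatr_eq0 -lt0n.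
set w := expC ('i%C * (2 * pi%:C * (x / n%:R))).
have wn : w ^+ n = expC ('i%C * (2 * pi%:C * x)).
  by rewrite -expCMn -mulr_natr; congr expC; field.
have term (r : nat) : cscC (2 * pi%:C * ((x + r%:R) / n%:R))
    = let u := w * expC ('i%C * (2 * pi%:C / n%:R)) ^+ r in
      2 * 'i%C * (u / (u ^+ 2 - 1)).
  rewrite cscCE -[_ ^+ r]expCMn -expCD /=.
  suff -> : 'i%C * (2 * pi%:C * ((x + r%:R) / n%:R)) =
    'i%C * (2 * pi%:C * (x / n%:R)) + 'i%C * (2 * pi%:C / n%:R) *+ r by [].
  by rewrite -mulr_natr; field.
under eq_bigr => r _ do rewrite term.
rewrite -mulr_sumr sum_frac_prim_root //; last 2 first.
- exact: prim_root_expC.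
(* A vanishing denominator would mean 2 pi x = k pi, that is 2x = k. *)
- rewrite wn; apply/eqP => /expC_sqr_eq1[k kE]; apply: x_pole; exists k.
  apply: (mulIf (pic_neq0 R)); apply: (mulfI (ic_neq0 R)); rewrite -kE; ring.
by rewrite wn cscCE mulrCA mulKf.
Qed.

(** * The Jacobi symbol at -1 *)

Lemma sqrN1_finField (F : finFieldType) : odd #|F| -> (-1 : F) != 1 ->
  [exists c : F, c ^+ 2 == -1] = ~~ odd #|F|./2.
Proof.
set m := #|F|./2 => card_odd N1_neq1.
have cardF : #|F| = m.*2.+1 by rewrite /m; lia.
have expm (x : F) : x != 0 -> x ^+ m ^+ 2 = 1.
  move=> x_neq0; apply: (mulfI x_neq0).
  by rewrite -exprM muln2 -exprS -cardF expf_card mulr1.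
(* Euler's criterion: c^2 = -1 gives (-1)^m = (c^m)^2 = 1, which for odd m contradicts -1 != 1. *)
apply/existsP/idP => [[c /eqP c2]|m_even].
  have c_neq0 : c != 0.
    by apply: contraNneq (oner_neq0 F) => c0; rewrite -oppr_eq0 -c2 c0 expr0n.
  apply: contraNN N1_neq1 => m_odd.
  by have := expm _ c_neq0; rewrite exprAC c2 -signr_odd m_odd expr1 => ->.
(* X^m - 1 has at most m roots, fewer than the 2m nonzero elements. So x^m = -1 for some x, and
   x^(m/2) is the required square root. *)
have [x x_neq0 xm] : exists2 x : F, x != 0 & x ^+ m != 1.
  apply/exists_inP; apply: contraT; rewrite negb_exists_in => /forall_inP all1.
  have m_gt0 : (0 < m)%N by have := finNzRing_gt1 F; rewrite cardF; lia.
  have := @max_unity_roots F m (enum (predC1 (0 : F))) m_gt0.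
  rewrite enum_uniq -cardE cardC1 cardF /= => H.
  have : (m.*2 <= m)%N.
    apply: H => //; apply/allP => x; rewrite mem_enum => /all1.
    by rewrite negbK unity_rootE.
  lia.
exists (x ^+ m./2); rewrite -exprM.
have -> : (m./2 * 2 = m)%N by lia.
by have /eqP := expm x x_neq0; rewrite sqrf_eq1 (negPf xm).
Qed.

Lemma legendreN1 (p : nat) : prime p -> odd p -> legendre (-1) p = (-1) ^+ p./2.
Proof.
move=> p_prime p_odd; have p_gt1 := prime_gt1 p_prime.
have p_char := pchar_Fp p_prime.
rewrite /legendre dvdzE /= dvdn1 gtn_eqF //.
have sqrE (b : nat) : (b%:Z ^+ 2 == -1 %[mod p])%Z = ((b%:R : 'F_p) ^+ 2 == -1).
  rewrite eqz_mod_dvd opprK -[_ + 1]/((b ^ 2 + 1)%N%:Z) dvdzE /=.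
  by rewrite (dvdn_pcharf p_char) natrD natrX addr_eq0.
(* The bound of the ordinal type ['F_p] is only provably equal to p, hence the cast by [Fp_cast]. *)
have -> : [exists b : 'I_p, (b%:Z ^+ 2 == -1 %[mod p])%Z]
    = [exists c : 'F_p, c ^+ 2 == -1].
  apply/existsP/existsP => -[b]; first by rewrite sqrE; exists b%:R.
  have b_lt : (b < p)%N by rewrite -{2}(Fp_cast p_prime).
  by exists (Ordinal b_lt); rewrite sqrE natr_Zp.
rewrite sqrN1_finField ?card_Fp //; last first.
  rewrite eq_sym -subr_eq0 opprK -(natrD _ 1 1) -(dvdn_pcharf p_char).
  by apply/negP => /dvdn_leq; lia.
by rewrite -signr_odd; case: odd.
Qed.

(** (2a+1)(2b+1) = 2(2ab+a+b) + 1, and 2ab does not affect the parity of the half. *)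
Lemma sign_halfM (m n : nat) : odd m -> odd n ->
  (-1) ^+ (m * n)./2 = (-1) ^+ m./2 * (-1) ^+ n./2 :> int.
Proof.
move=> m_odd n_odd; rewrite -exprD -signr_odd -[RHS]signr_odd; congr (_ ^+ _).
have [a ->] : exists a, m = a.*2.+1 by exists m./2; lia.
have [b ->] : exists b, n = b.*2.+1 by exists n./2; lia.
have -> : (a.*2.+1 * b.*2.+1 = (2 * a * b + a + b).*2.+1)%N by lia.
have halfK k : k.*2.+1./2 = k by lia.
by rewrite !halfK !oddD !oddM.
Qed.

Lemma jacobiN1 (n : nat) : odd n -> jacobi (-1) n = (-1) ^+ n./2.
Proof.
move=> n_odd; have n_gt0 : (0 < n)%N by case: n n_odd.
rewrite {2}(prod_prime_decomp n_gt0) prime_decompE big_map /jacobi /=.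
(* Oddness is carried through the induction because [sign_halfM] needs both factors odd. *)
suff [] : odd (\prod_(p <- primes n) p ^ logn p n)%N /\
  \prod_(p <- primes n) legendre (-1) p ^+ logn p n
  = (-1) ^+ (\prod_(p <- primes n) p ^ logn p n)%N./2 by [].
rewrite !big_seq.
elim/big_ind2: _ => [|x1 x2 y1 y2 [o2 ->] [o4 ->]|p] //.
  by rewrite oddM o2 o4 sign_halfM.
rewrite mem_primes => /and3P[p_prime _ p_dvd].
have p_odd : odd p by exact: dvdn_odd n_odd.
rewrite legendreN1 //; elim: (logn p n) => // k [o_pk IHk].
by rewrite expnS exprS oddM p_odd o_pk sign_halfM // IHk.
Qed.

Theorem corollary1p1 (R : realType) (n : nat) (n_gt0 : (0 < n)%N)
    (n_odd : odd n) :
  (forall x : R[i], ~ (exists m : int, 2 * x = m%:~R) ->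
     n%:R^-1 * (\sum_(r < n) cscC (2 * pi%:C * ((x + r%:R) / n%:R)))
     = cscC (2 * pi%:C * x))
  /\
  (forall x : R[i], ~ (exists m : int, 4 * x = (2 * m + 1)%:~R) ->
     n%:R^-1 * (\sum_(r < n) secC (2 * pi%:C * ((x + r%:R) / n%:R)))
     = (jacobi (-1) n)%:~R * secC (2 * pi%:C * x)).
Proof.
have n_neq0 : n%:R != 0 :> R[i] by rewrite pnatr_eq0 -lt0n.
have pihalfE : (pi / 2)%:C = pi%:C / 2 :> R[i] by rewrite rmorphM fmorphV rmorph_nat.
split=> x x_pole; first exact: sum_cscC.
have shiftE : 2 * pi%:C * (x + n%:R / 4) = 2 * pi%:C * x + (pi / 2)%:C *+ n.
  by rewrite -mulr_natr pihalfE; field.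
rewrite jacobiN1 // rmorphXn rmorphN1 /= -cscCD_odd_pihalf // -shiftE -(@sum_cscC _ n) //.
  (* In each term n/4 gets multiplied by 2 pi / n, so the shift is exactly pi/2. *)
  congr (_ * _); apply: eq_bigr => r _.
  rewrite /secC -sinCDpihalf /cscC pihalfE; congr (sinC _)^-1; field.
  exact: n_neq0.
(* If 2(x + n/4) = m, then 4x = 2m - n = 2(m - (n-1)/2 - 1) + 1 is odd. *)
case=> m mE; apply: x_pole; exists (m - n./2%:Z - 1).
have -> : 4 * x = 2 * (2 * (x + n%:R / 4)) - n%:R by field.
rewrite mE -[n in LHS]odd_double_half n_odd -[n./2.*2]muln2 natrD natrM.
rewrite rmorphD rmorphM !rmorphB /= -!pmulrn; ring.
Qed.
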